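(* Consider an impartial selection mechanism that is $\alpha$-optimal on $\mathcal{G}_n^+$, the set of loopless directed graphs on vertex set $\{1,\dots,n\}$ in which every vertex has outdegree at least $1$. Then \[ \alpha\le\begin{cases}3/4 & \text{if } n=3,\\ (3n-1)/(4n) & \text{otherwise.}\end{cases} \]
   Context: For $n\in\mathbb{N}$, $\mathcal{G}_n$ is the set of directed graphs $G=(N,E)$ with $N=\{1,\dots,n\}$ and $E\subseteq\{(i,j)\in N\times N: i\ne j\}$, and $\mathcal{G}=\bigcup_{n\in\mathbb{N}}\mathcal{G}_n$. $\delta^-(i,G)$ is the indegree of vertex $i$ in $G$ and $\Delta(G)=\max_{i\in N}\delta^-(i,G)$. $\mathcal{G}_n^+$ is the set of $G\in\mathcal{G}_n$ in which every vertex has at least one outgoing edge. A selection mechanism is a family of functions $f:\mathcal{G}_n\to[0,1]^n$ (one for each $n$) mapping each graph to a probability distribution on its vertices. It is impartial if for every pair of graphs $G=(N,E)$, $G'=(N,E')$ in $\mathcal{G}$ on the same vertex set and every $i\in N$, $(f(G))_i=(f(G'))_i$ whenever $E\setminus(\{i\}\times N)=E'\setminus(\{i\}\times N)$, i.e., the probability of selecting $i$ does not depend on the outgoing edges of $i$. It is $\alpha$-optimal on a set $\mathcal{G}'\subseteq\mathcal{G}$, for $\alpha\le1$, if $\mathbb{E}_{i\sim f(G)}[\delta^-(i,G)]\ge\alpha\,\Delta(G)$ for every $G\in\mathcal{G}'$ with $\Delta(G)>0$.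
   Formalization: The formal theorem assumes n ≥ 3: for n = 1 the class G_1^+ is empty, and for n = 2 its only graph has both indegrees 1, so the uniform mechanism is impartial and 1-optimal, contradicting the stated bounds 1/2 and 5/8. *)

(* Defs.v *)
From HB Require Import structures.
From mathcomp Require Import all_boot all_order all_algebra.
From mathcomp Require Import reals.
Set Implicit Arguments.
Unset Strict Implicit.
Unset Printing Implicit Defensive.
Import Order.TTheory GRing.Theory Num.Theory.

Local Open Scope ring_scope.

(* The vertex set {1, ..., n} is represented by 'I_n. *)
Record digraph (n : nat) := Digraph {
  edges : {set 'I_n * 'I_n};
  edges_loopless : [forall i, (i, i) \notin edges] }.

HB.instance Definition _ n := [isSub for @edges n].
HB.instance Definition _ n := [Finite of digraph n by <:].

Definition indeg n (G : digraph n) (i : 'I_n) : nat :=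
  #|[set j | (j, i) \in edges G]|.

Definition outdeg n (G : digraph n) (i : 'I_n) : nat :=
  #|[set j | (i, j) \in edges G]|.

Definition max_indeg n (G : digraph n) : nat := \max_(i < n) indeg G i.

(* A set of digraphs of arbitrary orders, i.e. a subset of the union over m of
   the sets of digraphs on m vertices. *)
Definition graph_class := forall m : nat, pred (digraph m).

Definition digraphs_plus (n : nat) : graph_class :=
  fun m G => (m == n) && [forall i, (0 < outdeg G i)%N].

(* There is no probability distribution on 'I_0, hence the side condition of
   [select_sum]. *)
Record mechanism (R : realType) := Mechanism {
  select : forall n : nat, digraph n -> 'I_n -> R;
  select_itv : forall n (G : digraph n) (i : 'I_n), 0 <= select G i <= 1;
  select_sum : forall n (G : digraph n), (0 < n)%N ->
    \sum_(i < n) select G i = 1 }.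

Definition impartial (R : realType) (f : mechanism R) : Prop :=
  forall n (G G' : digraph n) (i : 'I_n),
    edges G :\: setX [set i] [set: 'I_n] =
      edges G' :\: setX [set i] [set: 'I_n] ->
    select f G i = select f G' i.

Definition expected_indeg (R : realType) (f : mechanism R) n
    (G : digraph n) : R :=
  \sum_(i < n) select f G i * (indeg G i)%:R.

Definition optimal_on (R : realType) (f : mechanism R) (alpha : R)
    (C : graph_class) : Prop :=
  forall m (G : digraph m), C m G -> (0 < max_indeg G)%N ->
    alpha * (max_indeg G)%:R <= expected_indeg f G.

(* Main.v *)
(* Averaging over all relabellings makes the mechanism symmetric. Take a
   permutation p exchanging a and b, and the graph with edges i -> p i, except
   that a third vertex c points to a and b instead; c may be the only fixed
   point of p. If q is the probability of c, then that of a is at most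
   (1 - q) / 2 by symmetry. When a redirects its edge to p c, its indegree stays
   2 while all others become 1, so 2 alpha <= 1 + (1 - q) / 2. For n = 3 use
   q >= 0. If n = 4 or n >= 6, let p be fixed-point free with two disjoint
   transpositions: some vertex c has probability at least 1 / n in the graph of
   p, and one of the two transpositions avoids c, so q >= 1 / n. Such p do not
   exist for n = 5, where p = (0 1) (4 3 2) is used, and q is bounded below by
   relating a few graphs to one another. *)
Require Import Defs.
From mathcomp Require Import all_boot all_order all_algebra.
From mathcomp Require Import all_fingroup.
From mathcomp Require Import reals.
From mathcomp Require Import zify lra.
Import Order.TTheory GRing.Theory Num.Theory.

Local Open Scope ring_scope.

(** * Averaging a mechanism over all relabellings *)

Lemma loopless_of_relP {n : nat} (e : rel 'I_n) :
  [forall i, (i, i) \notin [set p : 'I_n * 'I_n | (p.1 != p.2) && e p.1 p.2]].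
Proof. by apply/forallP => i; rewrite inE /= eqxx. Qed.

Definition digraph_of_rel {n : nat} (e : rel 'I_n) : digraph n :=
  Digraph (loopless_of_relP e).

(** Vertex [i] of [e] appears as [t^-1 i] in the relabelled graph [relpre t e], whence the argument
    of [select]. *)
Definition sym_select {R : realType} (f : mechanism R) {n : nat}
    (e : rel 'I_n) (i : 'I_n) : R :=
  (n`!%:R)^-1 * \sum_(t : 'S_n)
    select f (digraph_of_rel (relpre t e)) ((t^-1)%g i).

Lemma sym_select_ge0 {R : realType} (f : mechanism R) {n : nat}
    (e : rel 'I_n) (i : 'I_n) : 0 <= sym_select f e i.
Proof.
rewrite mulr_ge0 ?invr_ge0 ?ler0n// sumr_ge0// => t _.
by case/andP: (select_itv f (digraph_of_rel (relpre t e)) ((t^-1)%g i)).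
Qed.

Lemma fact_neq0 {R : realType} (n : nat) : n`!%:R != 0 :> R.
Proof. by rewrite pnatr_eq0 -lt0n fact_gt0. Qed.

Lemma sym_select_sum {R : realType} (f : mechanism R) {n : nat}
    (e : rel 'I_n) : (0 < n)%N -> \sum_i sym_select f e i = 1.
Proof.
move=> n_gt0; rewrite -mulr_sumr exchange_big /= -[RHS](mulVf (fact_neq0 n)).
congr (_ * _); rewrite -[in RHS](card_Sn n) -[RHS]sumr_const.
apply: eq_bigr => t _; rewrite (reindex_perm t) /=.
rewrite -[RHS](select_sum f (digraph_of_rel (relpre t e)) n_gt0).
by apply: eq_bigr => i _; rewrite permK.
Qed.

(* Impartiality and invariance under relabelling by [s] in one statement. *)
Lemma sym_select_relabel {R : realType} (f : mechanism R) {n : nat}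
    (e e' : rel 'I_n) (i : 'I_n) (s : 'S_n) :
  impartial f -> (forall j k, j != i -> e j k = e' (s j) (s k)) ->
  sym_select f e i = sym_select f e' (s i).
Proof.
move=> imp_f ee'; congr (_ * _).
rewrite [RHS](reindex_inj (mulIg s)) /=; apply: eq_bigr => t _.
rewrite invMg permM permK; apply: imp_f; apply/setP => -[j k].
rewrite !inE /= andbT; case: (boolP (j == _)) => //= neq_j; congr (_ && _).
by rewrite !permM ee' //; apply: contraNneq neq_j => <-; rewrite permK.
Qed.

(** With indegree 2 at [a] and 1 elsewhere, the expected indegree is 1 plus the probability of [a];
    this holds in each relabelling, hence on average. *)
Lemma sym_select_optimal {R : realType} (f : mechanism R) (alpha : R) {n : nat}
    (e : rel 'I_n) (a : 'I_n) :
  optimal_on f alpha (digraphs_plus n) ->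
  irreflexive e -> (forall i, exists j, e i j) ->
  (forall i, #|[set j | e j i]| = (i == a).+1) ->
  2 * alpha <= 1 + sym_select f e a.
Proof.
move=> opt_f irr_e out_e in_e.
have n_gt0 : (0 < n)%N by apply: leq_ltn_trans (ltn_ord a).
suff opt_t (t : 'S_n) : 2 * alpha <=
    1 + select f (digraph_of_rel (relpre t e)) ((t^-1)%g a).
  have := ler_sum (index_enum _) (fun (t : 'S_n) (_ : true) => opt_t t).
  rewrite big_split /= !sumr_const card_Sn -[_ *+ _]mulr_natl => sum_le.
  have nfact_gt0 : (0 : R) < n`!%:R by rewrite ltr0n fact_gt0.
  rewrite -(ler_pM2l nfact_gt0).
  by rewrite mulrDr mulr1 [X in _ + X]mulrA mulfV ?fact_neq0// mul1r.
set G := digraph_of_rel _.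
have indegG i : indeg G i = ((i == (t^-1)%g a)).+1.
  rewrite -(inj_eq (@perm_inj _ t)) permKV -in_e /indeg.
  rewrite -[RHS](card_preimset _ (@perm_inj _ t)); apply: eq_card => j.
  by rewrite !inE /=; case: eqP => //= ->; rewrite irr_e.
have maxG : max_indeg G = 2%N.
  apply/eqP; rewrite eqn_leq; apply/andP; split.
    by apply/bigmax_leqP => i _; rewrite indegG; case: eqP.
  by rewrite -[2%N]/(true.+1) -(eqxx ((t^-1)%g a)) -indegG leq_bigmax.
have := opt_f n G; rewrite maxG [alpha * _]mulrC => opt_G.
apply: le_trans (opt_G _ isT) _.
  rewrite /digraphs_plus eqxx /=; apply/forallP => i.
  have [j eij] := out_e (t i); apply/card_gt0P; exists ((t^-1)%g j).
  rewrite !inE /= permKV eij andbT; apply: contraTneq eij => ->.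
  by rewrite permKV irr_e.
rewrite -{1}(select_sum f G n_gt0) /expected_indeg.
rewrite (bigD1 ((t^-1)%g a)) //= [in leRHS](bigD1 ((t^-1)%g a)) //=.
rewrite indegG eqxx mulr_natr mulr2n -!addrA lerD2l [leRHS]addrC lerD2l.
by apply: ler_sum => i /negPf neq_i; rewrite indegG neq_i mulr1.
Qed.

(** * Permutation graphs with one vertex pointing to an exchanged pair *)

Definition pair_rel {n : nat} (p : 'S_n) (a b c : 'I_n) : rel 'I_n :=
  fun i j => if i == c then (j == a) || (j == b) else j == p i.

(* [a] and [b] share their probability by symmetry. When [a] redirects its edge
   from [b] to [p c], it becomes the only vertex of indegree 2, all others
   having indegree 1, while its own probability does not change. *)
Lemma pair_rel_bound {R : realType} (f : mechanism R) (alpha : R) {n : nat}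
    (p : 'S_n) (a b c : 'I_n) :
  impartial f -> optimal_on f alpha (digraphs_plus n) ->
  p a = b -> p b = a -> c != a -> c != b -> (forall i, i != c -> p i != i) ->
  sym_select f (pair_rel p a b c) c <= 3 - 4 * alpha.
Proof.
move=> imp_f opt_f pa pb neq_ca neq_cb fixp.
have neq_ab : a != b by rewrite -pa eq_sym fixp // eq_sym.
have neq_ac : a != c by rewrite eq_sym.
have neq_bc : b != c by rewrite eq_sym.
have n_gt0 : (0 < n)%N by apply: leq_ltn_trans (ltn_ord a).
pose e := pair_rel p a b c.
(* Products act from left to right, so [q] is [p] with the images of [a] and [c] exchanged. Adding
   the edge from [c] to [a] gives [e'], which differs from [e] only in the edge out of [a]. *)
pose q := (tperm a c * p)%g.
have qa : q a = p c by rewrite permM tpermL.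
have qc : q c = b by rewrite permM tpermR.
have qD i : i != a -> i != c -> q i = p i by move=> ia ic; rewrite permM tpermD // eq_sym.
pose e' : rel 'I_n := fun i j => (j == q i) || (i == c) && (j == a).
(* Exchanging [a] and [b] is an automorphism of [e], as [tperm a b] commutes with [p]. *)
have eb : sym_select f e a = sym_select f e b.
  rewrite -[b in RHS](tpermL a b); apply: sym_select_relabel => // j k _.
  rewrite /e /pair_rel; case: (altP (j =P c)) => [->|neq_jc].
    have tK x : (tperm a b k == x) = (k == tperm a b x).
      by rewrite -(inj_eq (@perm_inj _ (tperm a b))) tpermK.
    by rewrite tpermD // eqxx !tK tpermL tpermR orbC.
  have -> : (tperm a b j == c) = false.
    by rewrite -(inj_eq (@perm_inj _ (tperm a b))) tpermK tpermD // (negPf neq_jc).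
  have -> : p (tperm a b j) = tperm a b (p j).
    case: tpermP => [->|->|ja jb]; first by rewrite pa pb tpermR.
      by rewrite pa pb tpermL.
    rewrite tpermD //; apply/eqP => pj.
      by apply: jb; apply: (@perm_inj _ p); rewrite pb.
    by apply: ja; apply: (@perm_inj _ p); rewrite pa.
  by rewrite (inj_eq perm_inj).
have ea : sym_select f e a = sym_select f e' a.
  rewrite -[a in RHS](perm1 a); apply: sym_select_relabel => // j k neq_ja.
  rewrite !perm1 /e /e' /pair_rel; case: (altP (j =P c)) => [->|neq_jc].
    by rewrite qc orbC.
  by rewrite qD // orbF.
have opt_a : 2 * alpha <= 1 + sym_select f e' a.
  apply: (sym_select_optimal f) => // [i|i|i].
  - rewrite /e'; case: (altP (i =P c)) => [->|neq_ic].
      by rewrite qc (negPf neq_cb) (negPf neq_ca).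
    rewrite orbF; case: (altP (i =P a)) => [->|neq_ia].
      by rewrite qa -{1}pb (inj_eq perm_inj) eq_sym (negPf neq_cb).
    by rewrite qD // eq_sym (negPf (fixp _ neq_ic)).
  - by exists (q i); rewrite /e' eqxx.
  have -> : [set j | e' j i] = (q^-1)%g i |: (if i == a then [set c] else set0).
    apply/setP => j; rewrite !inE /e' -(inj_eq (@perm_inj _ q)) permKV eq_sym.
    by congr (_ || _); case: (i == a); rewrite !inE ?andbT ?andbF.
  case: (altP (i =P a)) => [->|_]; last by rewrite setU0 cards1.
  rewrite cardsU1 cards1 inE -(inj_eq (@perm_inj _ q)) permKV qc.
  by rewrite neq_ab.
(* The probabilities of [a], [b] and [c] sum to at most 1, and those of [a] and [b] are at least
   [2 * alpha - 1] each. *)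
have := sym_select_sum f e n_gt0.
rewrite (bigD1 a) //= (bigD1 b) 1?eq_sym //= (bigD1 c) /=; last first.
  by rewrite neq_ca neq_cb.
have : 0 <= \sum_(i < n | (i != a) && (i != b) && (i != c)) sym_select f e i.
  by apply: sumr_ge0 => i _; apply: sym_select_ge0.
move: opt_a; rewrite -ea -eb -/e; lra.
Qed.

(** * Order 4 and orders at least 6 *)

Lemma two_transpositions_perm (n : nat) : (4 <= n)%N -> n != 5%N ->
  exists (p : 'S_n) (a b c d : 'I_n),
    [/\ uniq [:: a; b; c; d], p a = b, p b = a, p c = d & p d = c] /\
    forall i, p i != i.
Proof.
move=> n_ge4 n_neq5.
(* Swap 0 with 1 and 2 with 3, and rotate the other [n - 4] points; the rotation has a fixed point
   only if [n = 5]. *)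
pose h i := if i == 0%N then 1%N else if i == 1%N then 0%N else
  if i == 2%N then 3%N else if i == 3%N then 2%N else
  if i.+1 == n then 4%N else i.+1.
have h_lt (i : 'I_n) : (h i < n)%N by have := ltn_ord i; rewrite /h; do !case: ifP; lia.
pose p i := Ordinal (h_lt i).
have p_inj : injective p.
  move=> i j /(congr1 val) /=; have := ltn_ord i; have := ltn_ord j.
  by rewrite /h => ? ? hij; apply: val_inj => /=; move: hij; do !case: ifP; lia.
have lt0 : (0 < n)%N by lia.
have lt1 : (1 < n)%N by lia.
have lt2 : (2 < n)%N by lia.
have lt3 : (3 < n)%N by lia.
exists (perm p_inj), (Ordinal lt0), (Ordinal lt1), (Ordinal lt2), (Ordinal lt3).
split=> [|i]; first by split=> //; rewrite permE; apply: val_inj.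
rewrite permE -val_eqE /= /h; have := ltn_ord i; do !case: ifP; lia.
Qed.

Lemma exists_ge_mean {R : realType} {n : nat} (x : 'I_n -> R) :
  (0 < n)%N -> exists i, (\sum_j x j) / n%:R <= x i.
Proof.
move=> n_gt0; apply/existsP; apply: contraT; rewrite negb_exists => /forallP lt_x.
have n_pos : (0 : R) < n%:R by rewrite ltr0n.
suff : \sum_j x j < \sum_(j < n) (\sum_j x j) / n%:R.
  by rewrite sumr_const card_ord -[_ *+ _]mulr_natr divfK ?lt0r_neq0 // ltxx.
apply: ltr_sum => [|i _]; first by apply/hasP; exists (Ordinal n_gt0); rewrite ?mem_index_enum.
by rewrite ltNge lt_x.
Qed.

Lemma bound_neq5 {R : realType} (f : mechanism R) (alpha : R) {n : nat} :
  impartial f -> optimal_on f alpha (digraphs_plus n) ->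
  (4 <= n)%N -> n != 5%N -> alpha <= (3 * n%:R - 1) / (4 * n%:R).
Proof.
move=> imp_f opt_f n_ge4 n_neq5.
have n_gt0 : (0 < n)%N by lia.
have [p [a [b [c [d [[uniq_abcd pa pb pc pd] fixp]]]]]] :=
  two_transpositions_perm n n_ge4 n_neq5.
pose e : rel 'I_n := fun i j => j == p i.
have [v] := exists_ge_mean (sym_select f e) n_gt0.
rewrite sym_select_sum // => ge_v.
suff : sym_select f e v <= 3 - 4 * alpha.
  move=> le_v; have := le_trans ge_v le_v.
  have n_pos : (0 : R) < n%:R by rewrite ltr0n.
  rewrite ler_pdivrMr // ler_pdivlMr ?mulr_gt0 //; nra.
(* By impartiality, [v] keeps its probability when its edge is replaced by edges to [x] and [y]. *)
have pair_v x y : p x = y -> p y = x -> v != x -> v != y ->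
    sym_select f e v <= 3 - 4 * alpha.
  move=> px py neq_vx neq_vy.
  suff -> : sym_select f e v = sym_select f (pair_rel p x y v) v.
    exact: pair_rel_bound.
  rewrite -[v in RHS](perm1 v); apply: sym_select_relabel => // j k neq_jv.
  by rewrite !perm1 /pair_rel (negPf neq_jv).
have [va|neq_va] := eqVneq v a; last have [vb|neq_vb] := eqVneq v b.
- by apply: (pair_v c d) => //; rewrite va; move: uniq_abcd; rewrite /= !inE !negb_or => /and4P[/and3P[]].
- by apply: (pair_v c d) => //; rewrite vb; move: uniq_abcd;
     rewrite /= !inE !negb_or => /and4P[_ /andP[]].
- exact: (pair_v a b).
Qed.

(** * Order 5 *)

Definition adj_rel (l : seq (seq nat)) : rel 'I_5 :=
  fun i j => (j : nat) \in nth [::] l i.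

(** The list [s] holds the images of the relabelling; the condition is boolean, so concrete
    instances are settled by evaluation. *)
Lemma adj_rel_relabel {R : realType} (f : mechanism R)
    (l l' : seq (seq nat)) (i : nat) (s : seq nat) :
  impartial f -> (i < 5)%N -> perm_eq s (iota 0 5) ->
  all (fun j => (j == i) || all (fun k => (k \in nth [::] l j) ==
    (nth 0%N s k \in nth [::] l' (nth 0%N s j))) (iota 0 5)) (iota 0 5) ->
  sym_select f (adj_rel l) (inord i) =
  sym_select f (adj_rel l') (inord (nth 0%N s i)).
Proof.
move=> imp_f i_lt5 s_perm /allP all_s.
have size_s : size s = 5%N by rewrite (perm_size s_perm) size_iota.
have s_lt (k : 'I_5) : (nth 0%N s k < 5)%N.
  have : nth 0%N s k \in iota 0 5 by rewrite -(perm_mem s_perm) mem_nth ?size_s.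
  by rewrite mem_iota.
pose t (k : 'I_5) : 'I_5 := Ordinal (s_lt k).
have t_inj : injective t.
  move=> j k /(congr1 val) /= /eqP; rewrite nth_uniq ?size_s //.
    by move/eqP/val_inj.
  by rewrite (perm_uniq s_perm) iota_uniq.
have -> : inord (nth 0%N s i) = perm t_inj (inord i).
  by rewrite permE; apply: val_inj; rewrite /= !inordK ?(s_lt (Ordinal i_lt5)).
apply: sym_select_relabel => // j k neq_ji; rewrite !permE /adj_rel /=.
have j_iota : val j \in iota 0 5 by rewrite mem_iota /=.
have k_iota : val k \in iota 0 5 by rewrite mem_iota /=.
have := all_s _ j_iota; rewrite -[i in val j == i](inordK i_lt5) val_eqE.
by rewrite (negPf neq_ji) => /allP/(_ _ k_iota)/eqP.
Qed.

Lemma sum_ord5 {R : realType} (x : 'I_5 -> R) :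
  \sum_i x i = x (inord 0) + (x (inord 1) + (x (inord 2) +
    (x (inord 3) + x (inord 4)))).
Proof.
rewrite -(eq_bigr _ (fun i _ => congr1 x (inord_val i))).
by rewrite -(big_mkord xpredT (fun k => x (inord k))) unlock /= addr0.
Qed.

(* The probability [q] of vertex 2 in [l] is at most [3 - 4 * alpha] by
   [pair_rel_bound], and the probabilities of the other vertices in [l] also
   occur in the 5-cycle [c5] and in [m]. Vertex 0 in [m] has the probability of
   the vertex of indegree 2 in [k], so [2 * alpha - 1 - 1 / 5 <= q]. *)
Lemma bound_5 {R : realType} (f : mechanism R) (alpha : R) :
  impartial f -> optimal_on f alpha (digraphs_plus 5) -> alpha <= 7 / 10.
Proof.
move=> imp_f opt_f.
pose c5 : seq (seq nat) := [:: [:: 1]; [:: 2]; [:: 3]; [:: 4]; [:: 0]]%N.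
pose k : seq (seq nat) := [:: [:: 1]; [:: 2]; [:: 0; 3]; [:: 4]; [:: 2]]%N.
pose l : seq (seq nat) := [:: [:: 1]; [:: 0]; [:: 0]; [:: 2]; [:: 3]]%N.
pose m : seq (seq nat) := [:: [:: 1]; [:: 0]; [:: 0]; [:: 1]; [:: 2]]%N.
pose x g i := sym_select f (adj_rel g) (inord i).
have relabel g g' i s := @adj_rel_relabel R f g g' i s imp_f.
(* Rotation is an automorphism of the 5-cycle, so all its vertices have probability 1/5. *)
have rot_c5 i : (i < 5)%N -> x c5 i = x c5 (nth 0 [:: 1; 2; 3; 4; 0] i)%N.
  by move=> i_lt5; apply: relabel => //; case: i i_lt5 => [|[|[|[|[|]]]]].
have c01 := rot_c5 0%N isT; have c12 := rot_c5 1%N isT.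
have c23 := rot_c5 2%N isT; have c34 := rot_c5 3%N isT.
have l0 : x l 0%N = x m 1%N := relabel l m 0%N [:: 1; 3; 0; 2; 4]%N isT isT isT.
have l1 : x l 1%N = x c5 4%N := relabel l c5 1%N [:: 3; 4; 2; 1; 0]%N isT isT isT.
have l3 : x l 3%N = x m 2%N := relabel l m 3%N [:: 1; 0; 3; 2; 4]%N isT isT isT.
have l4 : x l 4%N = x m 3%N := relabel l m 4%N [:: 0; 1; 2; 4; 3]%N isT isT isT.
have m0 : x m 0%N = x k 2%N := relabel m k 0%N [:: 2; 1; 4; 0; 3]%N isT isT isT.
have sum_x g : x g 0%N + (x g 1%N + (x g 2%N + (x g 3%N + x g 4%N))) = 1.
  by rewrite -(sum_ord5 (sym_select f (adj_rel g))) sym_select_sum.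
have m4 : 0 <= x m 4%N := sym_select_ge0 _ _ _.
have k2 : 2 * alpha <= 1 + x k 2%N.
  apply: sym_select_optimal => // [i|i|i].
  - by case: i => [[|[|[|[|[|]]]]]].
  - exists (inord (head 0%N (nth [::] k i))).
    by rewrite /adj_rel inordK; case: i => [[|[|[|[|[|]]]]]].
  - rewrite -sum1dep_card big_mkcond /= !big_ord_recl big_ord0 /adj_rel -val_eqE /= inordK //.
    by case: i => [[|[|[|[|[|]]]]]].
have l2 : x l 2%N <= 3 - 4 * alpha.
  (* The graph of (0 1)(2 4 3) differs from [l] only in the edge out of 2. *)
  pose h (i : nat) := nth 0%N [:: 1; 0; 4; 2; 3]%N i.
  have h_lt (i : 'I_5) : (h i < 5)%N by case: i => [[|[|[|[|[|]]]]]].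
  pose p (i : 'I_5) : 'I_5 := Ordinal (h_lt i).
  have p_inj : injective p.
    by move=> i j /(congr1 val)/eqP; rewrite nth_uniq // => /eqP/val_inj.
  pose o i : 'I_5 := inord i.
  have -> : x l 2%N =
      sym_select f (pair_rel (perm p_inj) (o 0) (o 1%N) (o 2%N)) (o 2%N).
    rewrite -[o 2%N in RHS](perm1 (o 2%N)).
    apply: sym_select_relabel => // i j /negPf neq_i2.
    rewrite !perm1 /pair_rel neq_i2 permE /adj_rel -val_eqE /=.
    move: neq_i2; rewrite -val_eqE /= inordK //.
    by case: i => [[|[|[|[|[|]]]]] ?] //=; rewrite inE.
  apply: pair_rel_bound => //.
  - by rewrite permE; apply: val_inj; rewrite /= !inordK.
  - by rewrite permE; apply: val_inj; rewrite /= !inordK.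
  - by rewrite -val_eqE /= !inordK.
  - by rewrite -val_eqE /= !inordK.
  - by move=> i _; rewrite permE -val_eqE; case: i => [[|[|[|[|[|]]]]]].
(* Together, [2 * alpha - 6 / 5 <= x l 2 <= 3 - 4 * alpha], hence [6 * alpha <= 21 / 5]. *)
have := sum_x c5; have := sum_x l; have := sum_x m.
rewrite /= in c01 c12 c23 c34; lra.
Qed.

(** * Order 3 and the general bound *)

Lemma bound_3 {R : realType} (f : mechanism R) (alpha : R) :
  impartial f -> optimal_on f alpha (digraphs_plus 3) -> alpha <= 3 / 4.
Proof.
move=> imp_f opt_f.
pose a : 'I_3 := ord0; pose b : 'I_3 := lift ord0 ord0.
(* Here [ord_max] is the one fixed point that [pair_rel_bound] allows. *)
have le_c : sym_select f (pair_rel (tperm a b) a b ord_max) ord_max <= 3 - 4 * alpha.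
  apply: pair_rel_bound; rewrite ?tpermL ?tpermR // => i.
  case: tpermP => [->|->|/eqP neq_a /eqP neq_b neq_c] //.
  by move: i neq_a neq_b neq_c => [[|[|[|]]]].
have := sym_select_ge0 f (pair_rel (tperm a b) a b ord_max) ord_max; lra.
Qed.

Theorem theorem6 (R : realType) (f : mechanism R) (alpha : R) (n : nat)
    (n_ge3 : (3 <= n)%N) (alpha_le1 : alpha <= 1)
    (f_impartial : impartial f)
    (f_optimal : optimal_on f alpha (digraphs_plus n)) :
  alpha <= if n == 3%N then 3 / 4 else (3 * n%:R - 1) / (4 * n%:R).
Proof.
case: (altP (n =P 3%N)) => [n3|n_neq3].
  by rewrite n3 in f_optimal; apply: bound_3 f_optimal.
case: (altP (n =P 5%N)) => [n5|n_neq5]; last first.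
  by apply: (bound_neq5 f) => //; rewrite ltn_neqAle eq_sym n_neq3.
rewrite n5 in f_optimal *; have := bound_5 f alpha f_impartial f_optimal; lra.
Qed.
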